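(* For any $\epsilon > 0$ and $d \ge 1$, there exists $\beta = \beta(\epsilon,d) > 0$ such that for every nearest neighbor $\mathbb{Z}^d$ SFT $X$ with alphabet $A$, \[ h(X) > (\log|A|) - \beta \Longrightarrow X \text{ is } \epsilon\text{-full}. \] Also, for any $\beta > 0$ and $d \ge 1$, there exists $\epsilon = \epsilon(\beta,d) > 0$ such that for every nearest neighbor $\mathbb{Z}^d$ SFT $X$ with alphabet $A$, \[ X \text{ is } \epsilon\text{-full} \Longrightarrow h(X) > (\log|A|) - \beta. \]
   Context: Let $A$ be a finite alphabet and $\vec{e_1},\dots,\vec{e_d}$ the standard basis of $\mathbb{Z}^d$. A nearest neighbor $\mathbb{Z}^d$ SFT with alphabet $A$ is given by a set $\mathcal{F} \subseteq \bigcup_{i=1}^d A^{\{0,\vec{e_i}\}}$ of forbidden adjacent pairs; $X = X(\mathcal{F})$ is the set of all $x \in A^{\mathbb{Z}^d}$ such that no translate of a pattern in $\mathcal{F}$ appears in $x$. $X$ is always assumed nonempty. For $a,b \in A$, $i \in \{1,\dots,d\}$, $\tau \in \{\pm1\}$, the letter $b$ is a legal neighbor of $a$ in the $\tau\vec{e_i}$-direction if placing $a$ at the origin and $b$ at $\tau\vec{e_i}$ does not create a translate of a pattern in $\mathcal{F}$. For $\epsilon>0$, $X$ is $\epsilon$-full if $A$ can be partitioned into sets $G$ and $B$ such that (i) $|G| > (1-\epsilon)|A|$, and (ii) for all $g \in G$, $i \in \{1,\dots,d\}$, $\tau\in\{\pm1\}$, the set of legal neighbors of $g$ in the $\tau\vec{e_i}$-direction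 has cardinality greater than $(1-\epsilon)|A|$. For finite $S \subset \mathbb{Z}^d$, $L_S(X) = \{x|_S : x \in X\}$. The topological entropy is $h(X) = \lim_{n_1,\dots,n_d\to\infty} \frac{1}{\prod n_i}\log|L_{\prod_i [1,n_i]}(X)|$. *)

(* Defs.v *)
From HB Require Import structures.
From mathcomp Require Import all_boot all_order all_algebra finmap.
From mathcomp Require Import all_classical all_reals all_analysis.
Set Implicit Arguments.
Unset Strict Implicit.
Unset Printing Implicit Defensive.
Import Order.TTheory GRing.Theory Num.Theory.
Import numFieldNormedType.Exports.
Local Open Scope classical_set_scope.
Local Open Scope ring_scope.

Notation Zd d := 'rV[int]_d.

Definition basis_vec (d : nat) (i : 'I_d) : Zd d := delta_mx 0 i.

(* A forbidden pattern in A^{0, e_i} with a at 0 and b at e_i is encoded as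
   the triple (i, (a, b)). *)
Definition nn_patterns (d : nat) (A : finType) := {set 'I_d * (A * A)}.

Definition nn_sft (d : nat) (A : finType) (F : nn_patterns d A) :
    set (Zd d -> A) :=
  [set x | forall (v : Zd d) (i : 'I_d),
     (i, (x v, x (v + basis_vec i))) \notin F].

(* The direction is + e_i for tau = true and - e_i for tau = false; in the
   latter case b sits at - e_i and a at 0, a translate of b at 0, a at e_i. *)
Definition legal_neighbors (d : nat) (A : finType) (F : nn_patterns d A)
    (a : A) (i : 'I_d) (tau : bool) : {set A} :=
  [set b | (if tau then (i, (a, b)) else (i, (b, a))) \notin F]%SET.

Definition eps_full (R : realType) (d : nat) (A : finType)
    (F : nn_patterns d A) (eps : R) : Prop :=
  exists G B : {set A},
    [/\ G :|: B = [set: A]%SET,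
        [disjoint G & B]%B,
        #|G|%:R > (1 - eps) * #|A|%:R
      & forall (g : A) (i : 'I_d) (tau : bool), g \in G ->
          #|legal_neighbors F g i tau|%:R > (1 - eps) * #|A|%:R].

Definition language (d : nat) (A : finType) (X : set (Zd d -> A))
    (S : {fset Zd d}) : {set {ffun S -> A}} :=
  [set p | `[< exists2 x, X x & p = [ffun v : S => x (val v)] >]]%SET.

Definition box_set (d : nat) (n : 'I_d -> nat) : set (Zd d) :=
  [set v | forall i, (1 <= v 0 i) && (v 0 i <= (n i)%:Z)].

Definition box (d : nat) (n : 'I_d -> nat) : {fset Zd d} :=
  fset_set (box_set n).

(* fset_set is a junk value on infinite sets, whence this check. *)
Lemma box_set_finite (d : nat) (n : 'I_d -> nat) : finite_set (box_set n).
Proof.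
pose m := \max_(i < d) n i.
pose f (k : {ffun 'I_d -> 'I_m.+1}) : Zd d := \row_i (k i : nat)%:Z.
apply: (@sub_finite_set _ _ (f @` setT)); last exact/finite_image/finite_finset.
move=> v vbox; exists [ffun i => inord (absz (v 0 i))] => //.
apply/rowP => i; rewrite !mxE ffunE.
have /andP[v1 vn] := vbox i.
have v0 : 0 <= v 0 i by apply: le_trans v1.
rewrite inordK; first by rewrite gez0_abs.
rewrite ltnS (leq_trans _ (leq_bigmax i)) //.
by rewrite -lez_nat gez0_abs.
Qed.

Lemma in_box (d : nat) (n : 'I_d -> nat) (v : Zd d) :
  v \in box n = [forall i, (1 <= v 0 i) && (v 0 i <= (n i)%:Z)].
Proof.
rewrite /box in_fset_set; last exact: box_set_finite.
by apply/idP/forallP => [/set_mem//|h]; apply/mem_set.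
Qed.

(* The filter "n_1, ..., n_d -> oo". *)
Definition multi_oo (d : nat) : set_system ('I_d -> nat) :=
  filter_from [set: nat] (fun N => [set n | forall i, (N <= n i)%N]).
Arguments multi_oo : clear implicits.

Global Instance multi_oo_filter (d : nat) : ProperFilter (multi_oo d).
Proof.
apply: filter_from_proper => [|N _]; last by exists (fun=> N) => /=.
apply: filter_from_filter; first by exists 0%N.
move=> M N _ _; exists (maxn M N) => // n /= h.
by split=> i; have := h i; rewrite geq_max => /andP[].
Qed.

Definition entropy (R : realType) (d : nat) (A : finType)
    (X : set (Zd d -> A)) : R :=
  lim ((fun n : 'I_d -> nat =>
          ln (#|language X (box n)|%:R : R) / (\prod_(i < d) n i)%:R)
       @ multi_oo d).

(* Main.v *)
Require Import Defs.
From HB Require Import structures.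
From mathcomp Require Import all_boot all_order all_algebra finmap zify ring lra.
From mathcomp Require Import all_classical all_reals all_analysis.
Import Order.TTheory GRing.Theory Num.Theory.
Import numFieldNormedType.Exports.
Local Open Scope classical_set_scope.
Local Open Scope ring_scope.

(** Counting patterns on well-chosen boxes settles both implications, once the
    entropy is known to be the infimum, over boxes with positive sides, of the
    normalised logarithmic pattern counts [rate]. This is the multidimensional
    Fekete lemma ([cvg_rate], [entropyE]): a large box is covered by translates
    of a fixed box, and shift invariance bounds the number of patterns on the
    large box by a power of the number of patterns on the small one
    ([card_language_tile]). An upper bound on the entropy then needs one box
    only ([entropy_le_rate]), and a lower bound has to hold on every box
    ([entropy_ge]).

    High entropy implies fullness, with beta = eps^2 / (4 d). The box made of
    two sites adjacent in direction i carries at most as many patterns as there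
    are legal pairs in direction i, so that an entropy above ln |A| - beta
    leaves fewer than 2 beta |A|^2 illegal pairs ([card_illegal_lt]). By
    Markov's inequality ([markov_illegal]), fewer than eps |A| / (2 d) letters
    have too few legal neighbors in a given one of the 2 d directions, hence
    fewer than eps |A| letters are bad in some direction.

    Fullness implies high entropy, with (2 d + 1) eps = 1 - exp (- beta / 2).
    Fill the sites of Z^d one after the other, using only letters of the good
    set G. The at most 2 d neighbors already filled carry letters of G, so each
    of them rules out fewer than eps |A| letters; fewer than eps |A| letters lie
    outside G; hence more than (1 - (2 d + 1) eps) |A| letters remain at each
    step. The process never gets stuck, and it produces global configurations
    of the shift, so every box B carries at least
    ((1 - (2 d + 1) eps) |A|)^|B| patterns ([card_language_greedy]). *)

(** * Counting the patterns of a language *)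

(** A choice of a configuration extending each pattern turns [phi] into an
    injection of the language. *)
Lemma card_language_le (d : nat) (A : finType) (X : set (Zd d -> A))
    (S : {fset Zd d}) (T : finType) (D : {pred T}) (phi : (Zd d -> A) -> T) :
  (forall x, X x -> phi x \in D) ->
  (forall x y, X x -> X y -> phi x = phi y -> {in S, x =1 y}) ->
  (#|language X S| <= #|D|)%N.
Proof.
move=> phiD phiI.
have [->|/finset.set0Pn[p0]] := eqVneq (language X S) finset.set0.
  by rewrite finset.cards0.
rewrite inE => /asboolP[x0 _ _].
have /choice[r rP] : forall p : {ffun S -> A}, exists x : Zd d -> A,
    p \in language X S -> X x /\ p = [ffun v : S => x (val v)].
  move=> p; have [|np] := boolP (p \in language X S); last by exists x0.
  by rewrite inE => /asboolP[x Xx px]; exists x.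
have rI : {in language X S &, injective (phi \o r)}.
  move=> p q pX qX /= rpq; have [Xp ->] := rP _ pX; have [Xq ->] := rP _ qX.
  by apply/ffunP => v; rewrite !ffunE; exact: phiI rpq _ (valP v).
rewrite -(card_in_imset rI) subset_leq_card //.
by apply/fintype.subsetP => _ /imsetP[p pX ->]; apply: phiD; have [] := rP _ pX.
Qed.

Lemma card_language_ge (d : nat) (A : finType) (X : set (Zd d -> A))
    (S : {fset Zd d}) (T : finType) (psi : T -> Zd d -> A) :
  (forall t, X (psi t)) ->
  (forall t t', {in S, psi t =1 psi t'} -> t = t') ->
  (#|T| <= #|language X S|)%N.
Proof.
move=> psiX psiI.
pose f t := [ffun v : S => psi t (val v)].
have fI : injective f.
  move=> t t' /ffunP ff; apply: psiI => v vS.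
  by have := ff [` vS]%fset; rewrite !ffunE.
rewrite -(card_codom fI) subset_leq_card //.
apply/fintype.subsetP => _ /codomP[t ->]; rewrite inE; apply/asboolP.
by exists (psi t).
Qed.

(** * The number of sites of a box *)

Lemma absz_pred_lt (z : int) (n : nat) :
  (1 <= z) && (z <= n%:Z) -> ((absz z).-1 < n)%N.
Proof. by lia. Qed.

Lemma absz_predK (z : int) (n : nat) :
  (1 <= z) && (z <= n%:Z) -> (absz z).-1.+1%:Z = z.
Proof. by lia. Qed.

Lemma card_box (d : nat) (n : 'I_d -> nat) : #|{: box n}| = (\prod_i n i)%N.
Proof.
pose f (k : {dffun forall i : 'I_d, 'I_(n i)}) : Zd d := \row_i (k i).+1%:Z.
have fbox k : f k \in box n.
  by rewrite in_box; apply/forallP => i; rewrite mxE lez_nat ltn_ord.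
pose g k : box n := [` fbox k]%fset.
have gI : injective g.
  move=> k l /(congr1 val)/rowP kl; apply/ffunP => i; apply/val_inj.
  by have := kl i; rewrite !mxE => -[].
have gS (b : box n) : b \in codom g.
  have := valP b; rewrite in_box => /forallP bP.
  have bn i : ((absz (val b 0%R i)).-1 < n i)%N by exact: absz_pred_lt (bP i).
  apply/codomP; exists [ffun i => Ordinal (bn i)]; apply/val_inj/rowP => i.
  rewrite !mxE ffunE /=; symmetry; exact: absz_predK (bP i).
have -> : #|{: box n}| = #|codom g| by apply: eq_card => b; rewrite gS.
rewrite card_codom // card_dep_ffun foldrE big_image.
by apply: eq_bigr => i _; rewrite card_ord.
Qed.

(** * Greedy construction of configurations *)

Section Greedy.
Variables (d : nat) (A : finType) (F : nn_patterns d A) (G : {set A}) (k : nat).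

Definition legal_in (nb : 'I_d -> bool -> A) : {set A} :=
  [set a in G |
     [forall i, forall tau, a \in legal_neighbors F (nb i tau) i tau]]%SET.

(** The letter [around f v i tau] is the one that sees the site [v] in its own
    direction [tau] e_i: this is the convention under which the letters allowed
    at [v] form the set [legal_in (around f v)]. *)
Definition around (f : Zd d -> A) (v : Zd d) (i : 'I_d) (tau : bool) : A :=
  f (v - (if tau then basis_vec i else - basis_vec i)).

Variable a0 : A.

(** Sites are filled in the order of their code [choice.pickle]; at site [v] the
    number [c v] selects one of the letters compatible with the current values
    of all the neighbors. Initially every site carries [a0], itself a good
    letter, so that sites not filled yet need no special treatment: they only
    impose constraints that are stronger than necessary. *)
Fixpoint greedy_stage (c : Zd d -> nat) (n : nat) : Zd d -> A :=
  if n is m.+1 then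
    fun v => let f := greedy_stage c m in
      if choice.pickle v == m then nth a0 (enum (legal_in (around f v))) (c v)
      else f v
  else fun=> a0.

Definition greedy (c : Zd d -> nat) (v : Zd d) : A :=
  greedy_stage c (choice.pickle v).+1 v.

Lemma greedy_stageE c n v :
  (choice.pickle v < n)%N -> greedy_stage c n v = greedy c v.
Proof.
elim: n => // n IHn; rewrite ltnS leq_eqVlt => /predU1P[<-//|vn] /=.
by rewrite ltn_eqF // IHn.
Qed.

Hypothesis a0G : a0 \in G.
Hypothesis k_choices : forall nb : 'I_d -> bool -> A,
  (forall i tau, nb i tau \in G) -> (k <= #|legal_in nb|)%N.

Lemma greedy_stage_good c n v : (forall v, c v < k)%N ->
  greedy_stage c n v \in G.
Proof.
move=> ck; elim: n v => //= n IHn v; case: ifP => // _.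
set l := legal_in _.
suff : nth a0 (enum l) (c v) \in l by rewrite inE => /andP[].
rewrite -mem_enum mem_nth // -cardE (leq_trans (ck v)) //.
by apply: k_choices => i tau; exact: IHn.
Qed.

Lemma greedy_legal c v : (forall v, c v < k)%N ->
  greedy c v \in legal_in (around (greedy_stage c (choice.pickle v)) v).
Proof.
move=> ck; rewrite /greedy /= eqxx; set l := legal_in _.
rewrite -mem_enum mem_nth // -cardE (leq_trans (ck v)) //.
by apply: k_choices => i tau; exact: greedy_stage_good.
Qed.

(** Of two adjacent sites, the one filled last was given a letter compatible
    with the final value of the other one. *)
Lemma greedy_sft c : (forall v, c v < k)%N -> nn_sft F (greedy c).
Proof.
move=> ck v i; set w := v + basis_vec i.
have vNw : choice.pickle v != choice.pickle w.
  rewrite (inj_eq (pcan_inj choice.pickleK)) -subr_eq0 opprD addNKr.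
  by apply/eqP => /rowP/(_ i); rewrite !mxE !eqxx => /eqP; rewrite oppr_eq0.
case: ltngtP vNw => // [vw|wv] _.
  have := greedy_legal c w ck; rewrite inE => /andP[_].
  move=> /forallP/(_ i)/forallP/(_ true).
  by rewrite inE /around /= /w addrK greedy_stageE.
have := greedy_legal c v ck; rewrite inE => /andP[_].
move=> /forallP/(_ i)/forallP/(_ false).
by rewrite inE /around /= opprK -/w greedy_stageE.
Qed.

(** The selectors can be read off from the configuration: at the first site
    where two selectors differ, the same letters are available. The enumeration of
    Z^d need not start with [S], but the selectors agree outside [S]; so equal
    values on [S] give equal values at every site, stage after stage. *)
Lemma greedy_inj (S : {fset Zd d}) c c' :
    (forall v, c v < k)%N -> (forall v, c' v < k)%N ->
    (forall v, v \notin S -> c v = c' v) ->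
  {in S, greedy c =1 greedy c'} -> c =1 c'.
Proof.
move=> ck ck' cS gS.
have stE n : greedy_stage c n = greedy_stage c' n.
  elim: n => // n IHn; apply/funext => v /=; rewrite -IHn.
  case: eqP => // vn; have [vS|/cS->//] := boolP (v \in S).
  by have := gS _ vS; rewrite /greedy /= eqxx vn IHn.
move=> v; have := congr1 (fun f => f v) (stE (choice.pickle v).+1) => /=.
rewrite eqxx -stE => /eqP; set l := legal_in _.
have kl : (k <= #|l|)%N by apply: k_choices => i tau; exact: greedy_stage_good.
by rewrite nth_uniq ?enum_uniq -?cardE ?(leq_trans (ck _))
  ?(leq_trans (ck' _)) // => /eqP.
Qed.

(** Free selectors on [S], extended by 0 elsewhere, produce configurations with
    distinct restrictions to [S]. *)
Lemma card_language_greedy (S : {fset Zd d}) :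
  (0 < k)%N -> (k ^ #|{: S}| <= #|language (nn_sft F) S|)%N.
Proof.
move=> k0; rewrite -[X in (X ^ _)%N]card_ord -card_ffun.
pose ext (t : {ffun S -> 'I_k}) v := if insub v is Some s then t s : nat else 0%N.
have extk t v : (ext t v < k)%N by rewrite /ext; case: insub.
apply: (@card_language_ge _ _ _ _ _ (greedy \o ext)) => [t|t t' tt'].
  exact: greedy_sft.
have ee : ext t =1 ext t'.
  by apply: greedy_inj tt' => // v vS; rewrite /ext insubN.
apply/ffunP => s; apply/val_inj; have := ee (val s).
by rewrite /ext valK.
Qed.
End Greedy.

(** * Tiling a box by translates of a smaller one *)

Definition shift_invariant (d : nat) (A : finType) (X : set (Zd d -> A)) :=
  forall (x : Zd d -> A) (u : Zd d), X x -> X (fun v => x (v + u)).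

Lemma nn_sft_shift (d : nat) (A : finType) (F : nn_patterns d A) :
  shift_invariant d A (nn_sft F).
Proof. by move=> x u Xx v i; rewrite addrAC; exact: Xx. Qed.

(** Euclidean division by [m] for coordinates that start at 1. *)
Lemma tile_coordinate (z : int) (n q m : nat) : (0 < m)%N -> (n <= q * m)%N ->
  (1 <= z) && (z <= n%:Z) ->
  exists u v : int, [/\ (1 <= u) && (u <= q%:Z), (1 <= v) && (v <= m%:Z)
    & z = v + (u - 1) * m%:Z].
Proof.
move=> m0 nqm zn; pose a := (absz z).-1.
have an : (a < n)%N := absz_pred_lt z n zn.
exists (a %/ m).+1%:Z, (a %% m).+1%:Z; split.
- by rewrite !lez_nat /= ltn_divLR // (leq_trans an).
- by rewrite !lez_nat /= ltn_mod.
rewrite -(absz_predK z n zn) -/a; have := divn_eq a m.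
by move: (a %/ m)%N (a %% m)%N => k r; nia.
Qed.

(** The tiles may stick out of the large box, whence [<=] in the hypothesis:
    restrictions of one global configuration to each tile determine it on the
    large box, and shift invariance makes all of them patterns of [box m]. *)
Lemma card_language_tile (d : nat) (A : finType) (X : set (Zd d -> A))
    (n q m : 'I_d -> nat) :
  shift_invariant d A X -> (forall i, (0 < m i)%N) ->
  (forall i, (n i <= q i * m i)%N) ->
  (#|language X (box n)| <= #|language X (box m)| ^ \prod_i q i)%N.
Proof.
move=> Xs m0 nqm.
pose off (u : Zd d) : Zd d := \row_i ((u 0 i - 1) * (m i)%:Z).
rewrite -card_box -card_ffun_on.
apply: (@card_language_le _ _ _ _ _ _ (fun x =>
    [ffun u : box q => [ffun v : box m => x (val v + off (val u))]])).
  move=> x Xx; apply/ffun_onP => u; rewrite ffunE inE; apply/asboolP.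
  by exists (fun v => x (v + off (val u))) => //; exact: Xs.
move=> x y _ _ xy w; rewrite in_box => /forallP wn.
have /choice[u /choice[v uvP]] i :=
  tile_coordinate _ _ _ _ (m0 i) (nqm i) (wn i).
have ub : \row_i u i \in box q.
  by rewrite in_box; apply/forallP => i; rewrite mxE; have [] := uvP i.
have vb : \row_i v i \in box m.
  by rewrite in_box; apply/forallP => i; rewrite mxE; have [] := uvP i.
have -> : w = \row_i v i + off (\row_i u i).
  by apply/rowP => i; rewrite !mxE; have [] := uvP i.
have /ffunP/(_ [` ub]%fset) := xy; rewrite !ffunE.
by move=> /ffunP/(_ [` vb]%fset); rewrite !ffunE.
Qed.

(** * The entropy as an infimum *)

Section Entropy.
Variables (R : realType) (d : nat) (A : finType) (X : set (Zd d -> A)).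

Definition rate (n : 'I_d -> nat) : R :=
  ln (#|language X (box n)|%:R : R) / (\prod_(i < d) n i)%:R.

Hypotheses (X_shift : shift_invariant d A X) (X_neq0 : X !=set0).

Lemma card_language_gt0 (S : {fset Zd d}) : (0 < #|language X S|)%N.
Proof.
have [x Xx] := X_neq0; apply/card_gt0P; exists [ffun v : S => x (val v)].
by rewrite inE; apply/asboolP; exists x.
Qed.

Lemma ln_card_language_ge0 (S : {fset Zd d}) :
  0 <= ln (#|language X S|%:R : R).
Proof. by rewrite ln_ge0 // ler1n card_language_gt0. Qed.

Lemma rate_ge0 n : 0 <= rate n.
Proof. by rewrite divr_ge0 ?ln_card_language_ge0. Qed.

(** Take q_i = floor (n_i / m_i) + 1 tiles in direction i. Then
    q_i m_i <= n_i + m_i <= n_i (1 + M / N): the cost of incomplete tiles is a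
    factor 1 + M / N for each of the [d] directions. *)
Lemma rate_le (n m : 'I_d -> nat) (M N : nat) : (0 < N)%N ->
    (forall i, (0 < m i <= M)%N) -> (forall i, (N <= n i)%N) ->
  rate n <= (1 + M%:R / N%:R) ^+ d * rate m.
Proof.
move=> N0 mM Nn; pose q i := (n i %/ m i).+1.
have m0 i : (0 < m i)%N by case/andP: (mM i).
have n0 i : (0 < n i)%N by exact: leq_trans N0 (Nn i).
have nqm i : (n i <= q i * m i)%N by rewrite ltnW // ltn_ceil.
have Lnm : ln (#|language X (box n)|%:R : R)
    <= (\prod_i q i)%:R * ln (#|language X (box m)|%:R : R).
  rewrite mulr_natl -lnXn ?ltr0n ?card_language_gt0 // -natrX.
  rewrite ler_ln ?posrE ?ltr0n ?expn_gt0 ?card_language_gt0 // ler_nat.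
  exact: card_language_tile.
rewrite /rate ler_pdivrMr ?ltr0n ?prodn_gt0 //; apply: (le_trans Lnm).
rewrite [leRHS](_ : _ = (1 + M%:R / N%:R) ^+ d * (\prod_i n i)%:R /
  (\prod_i m i)%:R * ln (#|language X (box m)|%:R : R)); last by ring.
rewrite ler_wpM2r ?ln_card_language_ge0 //.
rewrite ler_pdivlMr ?ltr0n ?prodn_gt0 // !natr_prod.
rewrite -[X in _ ^+ X]card_ord -prodr_const -!big_split /=.
apply: ler_prod => i _; rewrite mulr_ge0 //=.
have N0R : 0 < N%:R :> R by rewrite ltr0n.
rewrite -(ler_pM2l N0R) [leRHS](_ : _ = (N%:R + M%:R) * (n i)%:R); last first.
  by field; rewrite gt_eqF.
rewrite -natrD -!natrM ler_nat.
have := leq_trunc_div (n i) (m i); have := Nn i; have /andP[_] := mM i.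
rewrite /q; nia.
Qed.

Definition rates : set R := [set rate m | m in [set m | forall i, (0 < m i)%N]].

Lemma rates_lb : has_lbound rates.
Proof. by exists 0 => _ [m _ <-]; exact: rate_ge0. Qed.

Lemma rates_neq0 : rates !=set0.
Proof. by exists (rate (fun=> 1%N)); exists (fun=> 1%N). Qed.

(** For a near-optimal box [m], the factor in [rate_le] tends to 1 as the common
    lower bound [N] of the sides of [n] grows. *)
Lemma cvg_rate : rate n @[n --> multi_oo d] --> inf rates.
Proof.
apply/cvgrPdist_lt => e e0.
have [_ [m m0 <-] mlt] := inf_adherent e0 (conj rates_neq0 rates_lb).
have cpow : (fun t : R => (1 + t) ^+ d * rate m) t @[t --> 0] --> rate m.
  have c1 : (1 + t) ^+ d @[t --> (0 : R)] --> (1 + 0 : R) ^+ d.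
    apply: (@cvg_comp _ _ _ (fun t : R => 1 + t) (fun t => t ^+ d)
      _ (nbhs (1 + 0 : R))); last exact: exprn_continuous.
    by apply: cvgD; [exact: cvg_cst|exact: cvg_id].
  by have := cvgM c1 (cvg_cst (rate m)); rewrite addr0 expr1n mul1r; apply.
have [dl /= dl0 dlP] : \forall t \near (0 : R),
    (1 + t) ^+ d * rate m < inf rates + e.
  by move/cvgr_lt : cpow; apply.
pose M := (\max_i m i)%N.
have [N [N0 NP]] : exists N, (0 < N)%N /\ M%:R / N%:R < dl.
  exists (Num.truncn (M%:R / dl)).+1; split => //.
  by rewrite ltr_pdivrMr // mulrC -ltr_pdivrMr // truncnS_gt.
exists N => // n /= Nn; rewrite ltr_distlC.
have Sn : rates (rate n) by exists n => // i; exact: leq_trans N0 (Nn i).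
have := ge_inf rates_lb Sn => le1.
rewrite (lt_le_trans _ le1) ?gtrBl //=.
apply: le_lt_trans (rate_le n m M N N0 _ Nn) _.
  by move=> i; rewrite m0 leq_bigmax.
by apply: dlP => /=; rewrite sub0r normrN ger0_norm.
Qed.

Lemma entropyE : entropy R X = inf rates.
Proof. exact: cvg_lim cvg_rate. Qed.

Lemma entropy_le_rate m : (forall i, (0 < m i)%N) -> entropy R X <= rate m.
Proof. by move=> m0; rewrite entropyE; apply: (ge_inf rates_lb); exists m. Qed.

Lemma entropy_ge c :
  (forall m, (forall i, (0 < m i)%N) -> c <= rate m) -> c <= entropy R X.
Proof.
move=> cP; rewrite entropyE; apply: lb_le_inf; first exact: rates_neq0.
by move=> _ [m m0 <-]; exact: cP.
Qed.

End Entropy.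

(** * Legal and illegal pairs *)

Lemma card_bigcup_le (I T : finType) (S : I -> {set T}) :
  (#|(\bigcup_i S i)%SET| <= \sum_i #|S i|)%N.
Proof.
elim/big_rec2: _ => [|i n U _ IH]; first by rewrite finset.cards0.
by rewrite (leq_trans (leq_card_setU _ _)) // leq_add2l.
Qed.

Lemma int_itv11 (z : int) : (1 <= z) && (z <= 1%N%:Z) -> z = 1.
Proof. lia. Qed.

Lemma int_itv12 (z : int) : z != 1 -> (1 <= z) && (z <= 2%N%:Z) -> z = 1 + 1.
Proof. lia. Qed.

Section PairCounts.
Variables (d : nat) (A : finType) (F : nn_patterns d A).

Definition legal_pairs (i : 'I_d) : {set A * A} :=
  [set p | (i, p) \notin F]%SET.

(** Sides of a box made of two sites adjacent in direction [i]. *)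
Definition domino (i : 'I_d) (j : 'I_d) : nat := if j == i then 2 else 1.

Lemma domino_gt0 i j : (0 < domino i j)%N.
Proof. by rewrite /domino; case: ifP. Qed.

Lemma prod_domino i : (\prod_j domino i j = 2)%N.
Proof.
rewrite (bigD1 i) //= big1 /domino ?eqxx // => j ji.
by rewrite (negbTE ji).
Qed.

Lemma card_language_domino i :
  (#|language (nn_sft F) (box (domino i))| <= #|legal_pairs i|)%N.
Proof.
pose o : Zd d := \row_j 1.
apply: (@card_language_le _ _ _ _ _ _ (fun x => (x o, x (o + basis_vec i)))).
  by move=> x Xx; rewrite inE; exact: Xx.
move=> x y _ _ [xo xoi] v; rewrite in_box => /forallP vP.
have [v1|v1] := eqVneq (v 0 i) 1.
  suff -> : v = o by [].
  apply/rowP => j; rewrite mxE; have := vP j; rewrite /domino.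
  by case: eqP => [->//|_]; exact: int_itv11.
suff -> : v = o + basis_vec i by [].
apply/rowP => j; rewrite !mxE eqxx /=; have := vP j; rewrite /domino.
case: eqP => [->|_] /=; last by rewrite addr0; exact: int_itv11.
exact: int_itv12.
Qed.

(** Every illegal pair in direction [i] is counted once, at its first letter
    when [tau] is true and at its second one when [tau] is false. *)
Lemma sum_illegal i tau :
  (\sum_g #|~: legal_neighbors F g i tau|)%N = #|~: legal_pairs i|.
Proof.
have cE (T : finType) (S : {set T}) : #|S| = (\sum_t (t \in S))%N.
  by rewrite -sum1_card big_mkcond; apply: eq_bigr => t _; case: (t \in S).
rewrite [RHS]cE; under eq_bigr do rewrite cE.
rewrite pair_big /=; case: tau; last first.
  rewrite -(pair_big xpredT xpredT
    (fun a b => (b \in ~: legal_neighbors F a i false) : nat)).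
  rewrite exchange_big pair_big /=.
  by apply: eq_bigr => -[a b] _; rewrite !inE.
by apply: eq_bigr => -[a b] _; rewrite !inE.
Qed.

End PairCounts.

(** * Entropy and fullness *)

Section EntropyFull.
Variables (R : realType) (d : nat) (A : finType) (F : nn_patterns d A).

(** Markov's inequality: a letter with at most (1 - eps) |A| legal neighbors
    belongs to at least eps |A| illegal pairs. *)
Lemma markov_illegal (eps : R) (i : 'I_d) (tau : bool) :
  #|[set g | ~~ ((1 - eps) * #|A|%:R
      < #|legal_neighbors F g i tau|%:R)]%SET|%:R * (eps * #|A|%:R)
    <= #|~: legal_pairs d A F i|%:R :> R.
Proof.
rewrite -(sum_illegal _ _ _ _ tau) -sum1_card !natr_sum mulr_suml.
rewrite [leRHS](bigID (fun g => g \in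
  [set g | ~~ ((1 - eps) * #|A|%:R
     < #|legal_neighbors F g i tau|%:R)]%SET)) /=.
rewrite ler_wpDr ?sumr_ge0 //; apply: ler_sum => g; rewrite inE -leNgt => gB.
have := cardsC (legal_neighbors F g i tau) => /(congr1 (fun n => n%:R : R)).
rewrite natrD mul1r; lra.
Qed.

Hypothesis X_neq0 : nn_sft F !=set0.

Let cardA_gt0 : (0 < #|A|)%N.
Proof. by have [x _] := X_neq0; apply/card_gt0P; exists (x 0). Qed.

(** With P legal pairs in direction [i], the two-site box gives
    2 (ln |A| - beta) < ln P, that is |A|^2 exp (- 2 beta) < P; conclude with
    exp (- 2 beta) >= 1 - 2 beta. *)
Lemma card_illegal_lt (beta : R) (i : 'I_d) :
  entropy R (nn_sft F) > ln (#|A|%:R) - beta ->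
  #|~: legal_pairs d A F i|%:R < 2 * beta * #|A|%:R ^+ 2.
Proof.
move=> hlt.
have A0 : 0 < #|A|%:R :> R by rewrite ltr0n.
have Xs := nn_sft_shift d A F.
have L0 := card_language_gt0 d A _ X_neq0 (box (domino d i)).
have LP := card_language_domino d A F i.
have P0 : 0 < #|legal_pairs d A F i|%:R :> R by rewrite ltr0n (leq_trans L0).
have := entropy_le_rate R d A _ Xs X_neq0 (domino d i) (domino_gt0 d i).
rewrite /rate prod_domino => hle.
have lnP : 2 * (ln #|A|%:R - beta) < ln (#|legal_pairs d A F i|%:R : R).
  have : ln (#|language (nn_sft F) (box (domino d i))|%:R : R)
      <= ln (#|legal_pairs d A F i|%:R : R).
    by rewrite ler_ln ?posrE ?ler_nat // ltr0n.
  lra.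
move: lnP; rewrite -ltr_expR lnK ?posrE // mulrBr expRD expRM_natl lnK ?posrE //.
move=> AP; have := expR_ge1Dx (- (2 * beta)).
have := cardsC (legal_pairs d A F i); rewrite card_prod.
move=> /(congr1 (fun n => n%:R : R)); rewrite natrD natrM => PE e1.
have : (1 - 2 * beta) * #|A|%:R ^+ 2 < #|legal_pairs d A F i|%:R.
  by apply: le_lt_trans AP; rewrite mulrC ler_pM2l ?exprn_gt0.
rewrite expr2 in PE *; lra.
Qed.

(** The constant is chosen so that 2 beta |A|^2 / (eps |A|) equals
    eps |A| / (2 d), the share of each of the 2 d directions in the union bound
    for the set of bad letters. *)
Lemma eps_full_of_entropy (eps : R) : 0 < eps -> (0 < d)%N ->
  entropy R (nn_sft F) > ln (#|A|%:R) - eps ^+ 2 / (4 * d%:R) ->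
  eps_full F eps.
Proof.
move=> eps0 d0 hlt.
have A0 : 0 < #|A|%:R :> R by rewrite ltr0n.
have d0R : 0 < d%:R :> R by rewrite ltr0n.
pose bad (p : 'I_d * bool) := [set g | ~~ ((1 - eps) * #|A|%:R
  < #|legal_neighbors F g p.1 p.2|%:R)]%SET.
have badlt p : #|bad p|%:R < eps * #|A|%:R / (2 * d%:R) :> R.
  have := le_lt_trans (markov_illegal eps p.1 p.2) (card_illegal_lt _ p.1 hlt).
  rewrite -/(bad p) -ltr_pdivlMr ?mulr_gt0 // => /lt_le_trans; apply.
  rewrite le_eqVlt; apply/orP/or_introl/eqP; field.
  by rewrite !gt_eqF.
pose B := (\bigcup_p bad p)%SET.
exists (~: B)%SET, B; split.
- by rewrite finset.setUC finset.setUCr.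
- by rewrite finset.disjoints_subset subxx.
- have BA : #|B|%:R < eps * #|A|%:R :> R.
    apply: (@le_lt_trans _ _ (\sum_p #|bad p|%:R)).
      by rewrite -natr_sum ler_nat; exact: card_bigcup_le.
    apply: (@lt_le_trans _ _
        (\sum_(p : 'I_d * bool) (eps * #|A|%:R / (2 * d%:R)))).
      apply: ltr_sum => //; apply/hasP.
      by exists (Ordinal d0, true); rewrite ?mem_index_enum.
    rewrite sumr_const card_prod card_ord card_bool -[leLHS]mulr_natr natrM.
    by rewrite le_eqVlt; apply/orP/or_introl/eqP; field; rewrite gt_eqF.
  have := cardsC B => /(congr1 (fun n => n%:R : R)); rewrite natrD; lra.
- move=> g i tau; rewrite inE => gB; apply: contraNT gB => gb.
  by apply/finset.bigcupP; exists (i, tau); rewrite ?inE.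
Qed.

(** Union bound for the letters unavailable to the greedy construction: those
    outside [G], and those illegal next to one of 2 d letters of [G]. *)
Lemma entropy_ge_of_eps_full (eps : R) : 0 < 1 - (2 * d%:R + 1) * eps ->
  eps_full F eps ->
  ln ((1 - (2 * d%:R + 1) * eps) * #|A|%:R) <= entropy R (nn_sft F).
Proof.
set s := 1 - _ => s0 [G [B [_ _ GA legalG]]].
have A0 : 0 < #|A|%:R :> R by rewrite ltr0n.
have r0 : 0 < s * #|A|%:R by rewrite mulr_gt0.
(* the least integer greater than s |A|, so that every set of more than s |A|
   letters offers k choices *)
pose k := (Num.truncn (s * #|A|%:R)).+1.
have GC : #|~: G|%:R < eps * #|A|%:R :> R.
  have := cardsC G => /(congr1 (fun n => n%:R : R)); rewrite natrD; lra.
have eps0 : 0 < eps by rewrite -(pmulr_lgt0 _ A0) (le_lt_trans _ GC).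
have [a0 a0G] : exists a0, a0 \in G.
  apply/card_gt0P; rewrite -(ltr0n R) (le_lt_trans _ GA) // mulr_ge0 //.
  have : 0 <= d%:R :> R by [].
  rewrite /s in s0; nra.
have kP (nb : 'I_d -> bool -> A) : (forall i tau, nb i tau \in G) ->
    (k <= #|legal_in d A F G nb|)%N.
  move=> nbG; rewrite truncn_lt_nat ?ltW //.
  pose bad (p : 'I_d * bool) := (~: legal_neighbors F (nb p.1 p.2) p.1 p.2)%SET.
  have sub :
      (~: legal_in d A F G nb \subset (~: G) :|: (\bigcup_p bad p))%SET.
    apply/fintype.subsetP => a; rewrite !inE negb_and => /orP[->//|].
    case/forallPn => i /forallPn[tau ai]; apply/orP; right.
    by apply/finset.bigcupP; exists (i, tau); rewrite ?inE // in ai *.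
  have badP p : #|bad p|%:R <= eps * #|A|%:R :> R.
    have := cardsC (legal_neighbors F (nb p.1 p.2) p.1 p.2).
    move=> /(congr1 (fun n => n%:R : R)); rewrite natrD.
    have := legalG _ p.1 p.2 (nbG p.1 p.2); rewrite /bad; lra.
  have cle : #|~: legal_in d A F G nb|%:R
      <= #|~: G|%:R + \sum_p #|bad p|%:R :> R.
    rewrite -natr_sum -natrD ler_nat (leq_trans (subset_leq_card sub)) //.
    by rewrite (leq_trans (leq_card_setU _ _)) // leq_add2l card_bigcup_le.
  have sle : \sum_p #|bad p|%:R <= 2 * d%:R * (eps * #|A|%:R) :> R.
    apply: (@le_trans _ _ (\sum_(p : 'I_d * bool) eps * #|A|%:R)).
      exact: ler_sum.
    rewrite sumr_const card_prod card_ord card_bool -[leLHS]mulr_natr natrM.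
    by rewrite le_eqVlt; apply/orP/or_introl/eqP; ring.
  have := cardsC (legal_in d A F G nb) => /(congr1 (fun n => n%:R : R)).
  rewrite natrD /s; lra.
apply: (entropy_ge R d A _ (nn_sft_shift d A F) X_neq0) => m m0.
have k0 : 0 < k%:R :> R by rewrite ltr0n.
rewrite /rate ler_pdivlMr ?ltr0n ?prodn_gt0 //.
apply: (@le_trans _ _ (ln (k%:R : R) * (\prod_i m i)%:R)).
  by rewrite ler_wpM2r // ler_ln ?posrE // ltW // truncnS_gt.
rewrite mulr_natr -lnXn // -natrX ler_ln ?posrE ?ltr0n ?expn_gt0 //.
  rewrite ler_nat -card_box.
  exact: card_language_greedy a0G kP _ _.
exact: card_language_gt0.
Qed.
End EntropyFull.

Theorem theorem2p32 (R : realType) :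
  (forall (eps : R) (d : nat), 0 < eps -> (1 <= d)%N ->
     exists2 beta : R, 0 < beta &
       forall (A : finType) (F : nn_patterns d A),
         nn_sft F !=set0 ->
         entropy R (nn_sft F) > ln (#|A|%:R) - beta ->
         eps_full F eps)
  /\
  (forall (beta : R) (d : nat), 0 < beta -> (1 <= d)%N ->
     exists2 eps : R, 0 < eps &
       forall (A : finType) (F : nn_patterns d A),
         nn_sft F !=set0 ->
         eps_full F eps ->
         entropy R (nn_sft F) > ln (#|A|%:R) - beta).
Proof.
split=> [eps d eps0 d0|beta d beta0 _].
  exists (eps ^+ 2 / (4 * d%:R)).
    by rewrite divr_gt0 ?exprn_gt0 ?mulr_gt0 ?ltr0n.
  by move=> A F X0; exact: eps_full_of_entropy.
have d1 : 0 < 2 * d%:R + 1 :> R by rewrite ltr_wpDl ?mulr_ge0.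
(* beta / 2 instead of beta makes the final inequality strict *)
pose eps : R := (1 - expR (- (beta / 2))) / (2 * d%:R + 1).
have epsE : 1 - (2 * d%:R + 1) * eps = expR (- (beta / 2)).
  by rewrite /eps; field; rewrite gt_eqF.
exists eps.
  by rewrite divr_gt0 // subr_gt0 expR_lt1 oppr_lt0 divr_gt0.
move=> A F X0 Feps.
have A0 : 0 < #|A|%:R :> R.
  by rewrite ltr0n; have [x _] := X0; apply/card_gt0P; exists (x 0).
have := entropy_ge_of_eps_full _ _ _ _ X0 eps.
rewrite epsE => /(_ (expR_gt0 _) Feps); apply: lt_le_trans.
rewrite lnM ?posrE ?expR_gt0 // expRK; lra.
Qed.
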